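(* Let $X\subset\mathbb{P}^4$ be an irreducible cubic hypersurface over $\mathbb{C}$ all of whose singular points are ordinary double points. Then the number $d$ of ordinary double points of $X$ satisfies $d\le 10$.
   Context: The ground field is $\mathbb{C}$. An ordinary double point (node) of a hypersurface is an isolated singular point of multiplicity 2 whose tangent cone (the quadratic leading term of a local equation) is a nondegenerate quadratic form. *)

(* Defs.v *)
From mathcomp Require Export all_boot all_order all_algebra.
From mathcomp Require Export complex.
From mathcomp Require Export mpoly.
From mathcomp Require Export classical_sets cardinality reals.

Set Implicit Arguments.
Unset Strict Implicit.
Unset Printing Implicit Defensive.

Import GRing.Theory.

Local Open Scope ring_scope.
Local Open Scope classical_set_scope.

Definition irreducible_elt (D : idomainType) (p : D) : Prop :=
  [/\ p != 0, p \isn't a GRing.unit &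
      forall q r : D,
        p = q * r -> q \is a GRing.unit \/ r \is a GRing.unit].

Section Hypersurfaces.
Variables (K : fieldType) (n : nat).

(* The points of P^n are the lines through the origin of K^(n+1). *)
Definition projspace : Type := {U : {vspace 'rV[K]_n.+1} | \dim U == 1%N}.

(* Homogeneous coordinates of P: those of a chosen nonzero vector of the line.
   All uses below are invariant under rescaling of this vector when the
   polynomials involved are homogeneous. *)
Definition hcoord (P : projspace) (j : 'I_n.+1) : K := vpick (val P) 0 j.

(* A hypersurface of P^n is given by its homogeneous equation F. *)
Definition on_hypersurface (F : {mpoly K[n.+1]}) (P : projspace) : Prop :=
  F.@[hcoord P] = 0.

Definition singular_point (F : {mpoly K[n.+1]}) (P : projspace) : Prop :=
  on_hypersurface F P /\ forall j : 'I_n.+1, (F^`M(j)).@[hcoord P] = 0.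

(* Isolated for the Zariski topology, of which the sets {G <> 0} with G
   homogeneous form a basis. *)
Definition isolated_singular_point (F : {mpoly K[n.+1]}) (P : projspace) :
    Prop :=
  singular_point F P /\
  exists (k : nat) (G : {mpoly K[n.+1]}),
    [/\ G \is k.-homog, G.@[hcoord P] != 0 &
        forall Q : projspace,
          singular_point F Q -> G.@[hcoord Q] != 0 -> Q = P].

(* In the affine chart x_i = 1, with coordinates translated so that P is the
   origin; meaningful when the i-th coordinate of P is nonzero. *)
Definition local_equation (F : {mpoly K[n.+1]}) (P : projspace)
    (i : 'I_n.+1) : {mpoly K[n]} :=
  F \mPo [tuple (hcoord P j / hcoord P i)%:MP
                + (if unlift i j is Some k then 'X_k else 0) | j < n.+1].

Definition multiplicity_at_origin (f : {mpoly K[n]}) (m : nat) : Prop :=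
  pihomog mdeg m f != 0 /\
  forall d : nat, (d < m)%N -> pihomog mdeg d f = 0.

(* The polar form (u, v) |-> q (u + v) - q u - q v has trivial radical. *)
Definition nondegenerate_quadratic (q : {mpoly K[n]}) : Prop :=
  q \is 2.-homog /\
  forall u : 'rV[K]_n,
    (forall v : 'rV[K]_n, q.@[(u + v) 0] - q.@[u 0] - q.@[v 0] = 0) -> u = 0.

(* The last condition does not depend on the chart i containing P. *)
Definition ordinary_double_point (F : {mpoly K[n.+1]}) (P : projspace) : Prop :=
  isolated_singular_point F P /\
  exists i : 'I_n.+1,
    [/\ hcoord P i != 0,
        multiplicity_at_origin (local_equation F P i) 2 &
        nondegenerate_quadratic (pihomog mdeg 2 (local_equation F P i))].

End Hypersurfaces.

(* Main.v *)
Require Import Defs.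
From mathcomp Require Import boolp functions ring zify.

(* Let T be the symmetric trilinear form of the cubic: a point x is singular
   when T(x,x,.) = 0, and it is a node when moreover T(x,.,.) has radical <x>.
   Fix a node P.  The quadratic form T(P,.,.) has rank 4, so in a hyperbolic
   frame its zeros modulo P form P^1 x P^1, embedded by Segre, and the other
   nodes of the cubic correspond to the singular points of the curve
   T(sigma,sigma,sigma) = 0 of bidegree (3,3), which are nodes as well.
   View the equation of the curve as a binary cubic over the first P^1; its
   discriminant has degree at most 12.  It vanishes to order at least 2 under a
   singular point and at least 4 under a vertical line contained in the curve;
   nodality forces its order to be at most 3 under a multiple root of a
   non-vertical fibre, so it is not zero.  There are k <= 3
   vertical lines, each carrying at most 3 singular points, and every other
   fibre carries at most one, so there are at most
   3k + (12 - 4k)/2 = 6 + k <= 9 singular points. *)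

Set Implicit Arguments.
Unset Strict Implicit.
Unset Printing Implicit Defensive.

Import GRing.Theory Num.Theory.

Local Open Scope ring_scope.

(** * Polynomials over a closed field and counting by fibres *)

Section ClosedField.
Variable K : closedFieldType.

Lemma horner_inj (p q : {poly K}) : (forall x, p.[x] = q.[x]) -> p = q.
Proof.
move=> H; apply/eqP; rewrite -subr_eq0; apply/negP=> /negP /closed_nonrootP[x].
by rewrite /root !hornerE H subrr eqxx.
Qed.

(** Each [u i] rules out at most one value of [s]. This later moves finitely many points of P^1 away
    from infinity. *)
Lemma exists_generic_shear (I : finType) (u : I -> K * K) :
  (forall i, u i != (0, 0)) -> exists s, forall i, (u i).1 - s * (u i).2 != 0.
Proof.
move=> u0; pose p i := ((u i).1%:P - (u i).2%:P * 'X : {poly K}).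
have p0 i : p i != 0.
  apply: contra (u0 i) => /eqP pi0; case E: (u i) => [a b].
  have := congr1 (coefp 0) pi0; have := congr1 (coefp 1) pi0.
  rewrite /p E /coefp /= !coefB !coefC !coefMX !coefC /= subr0 sub0r.
  by move=> /eqP; rewrite oppr_eq0 => /eqP-> ->.
have /closed_nonrootP[s] : \prod_i p i != 0 by apply/prodf_neq0.
rewrite rootE horner_prod => /prodf_neq0 H; exists s => i.
by have := H i isT; rewrite /p !hornerE mulrC.
Qed.

(** The powers at distinct points are pairwise coprime, so their product divides [D]. *)
Lemma sum_root_orders (D : {poly K}) (m : K -> nat) (ts : seq K) : D != 0 -> uniq ts ->
  (forall t, t \in ts -> ('X - t%:P) ^+ m t %| D) -> (\sum_(t <- ts) m t < size D)%N.
Proof.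
move=> D0 Us dv; pose q t := ('X - t%:P) ^+ m t : {poly K}.
have q0 t : q t != 0 by rewrite expf_neq0 ?polyXsubC_eq0.
have -> : (\sum_(t <- ts) m t)%N.+1 = size (\prod_(t <- ts) q t).
  elim: ts {Us dv} => [|t ts IH]; first by rewrite !big_nil size_poly1.
  rewrite !big_cons size_mul //;
    last by rewrite prodf_seq_neq0; apply/allP => u _; rewrite q0.
  by rewrite size_exp_XsubC -IH addnS.
apply: dvdp_leq => //; elim: ts Us dv => [|t ts IH /= /andP[nt Us] dv].
  by rewrite big_nil dvd1p.
rewrite big_cons Gauss_dvdp ?dv ?mem_head //.
  by apply: IH => // u uts; apply: dv; rewrite inE uts orbT.
apply: coprimep_expl; rewrite coprimep_sym coprimep_XsubC rootE horner_prod.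
rewrite prodf_seq_neq0; apply/allP => u uts /=; rewrite horner_exp !hornerE.
by rewrite expf_neq0 // subr_eq0; apply: contraNneq nt => ->.
Qed.

End ClosedField.

Lemma size_partition (A : eqType) (B : eqType) (f : A -> B) (s : seq A) :
  size s = (\sum_(b <- undup (map f s)) count (fun a => f a == b) s)%N.
Proof.
under eq_bigr do rewrite -sum1_count big_mkcond.
rewrite exchange_big -sum1_size /=; apply: eq_big_seq => a as_.
rewrite (bigD1_seq (f a)) ?undup_uniq ?mem_undup ?map_f //= eqxx.
by rewrite big1 // => b; rewrite eq_sym => /negPf->.
Qed.

(** * The discriminant of a binary cubic *)

(** Up to the factor -27, the discriminant of [a X^3 + 3 b X^2 Y + 3 c X Y^2 + d Y^3]. *)
Definition cubic_disc (R : pzRingType) (a b c d : R) : R :=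
  a ^+ 2 * d ^+ 2 - 6%:R * (a * b * c * d) + 4%:R * (a * c ^+ 3)
  + 4%:R * (b ^+ 3 * d) - 3%:R * (b ^+ 2 * c ^+ 2).

Lemma rmorph_cubic_disc (R S : pzRingType) (f : {rmorphism R -> S}) a b c d :
  f (cubic_disc a b c d) = cubic_disc (f a) (f b) (f c) (f d).
Proof. by rewrite /cubic_disc !(rmorphB, rmorphD, rmorphM, rmorphXn, rmorph_nat). Qed.

Lemma size_cubic_disc (R : nzRingType) (d : nat) (p q r s : {poly R}) :
  (size p <= d.+1)%N -> (size q <= d.+1)%N -> (size r <= d.+1)%N ->
  (size s <= d.+1)%N -> (size (cubic_disc p q r s) <= (4 * d).+1)%N.
Proof.
move=> Sp Sq Sr Ss.
have M m k (f g : {poly R}) : (size f <= m.+1)%N -> (size g <= k.+1)%N ->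
    (size (f * g)%R <= (m + k).+1)%N.
  move=> Sf Sg; apply: leq_trans (size_polyMleq _ _) _.
  by rewrite -subn1 leq_subLR add1n -addnS -addSn leq_add.
have E m k (f : {poly R}) : (size f <= m.+1)%N -> (size (f ^+ k)%R <= (m * k).+1)%N.
  move=> Sf; elim: k => [|k IH]; first by rewrite size_poly1.
  by rewrite exprS mulnS M.
have N m k (f : {poly R}) : (size f <= k)%N -> (size (m%:R * f)%R <= k)%N.
  by move=> Sf; rewrite -polyC_natr mul_polyC (leq_trans (size_scale_leq _ _)).
have D k (f g : {poly R}) : (size f <= k)%N -> (size g <= k)%N -> (size (f + g)%R <= k)%N.
  by move=> Sf Sg; rewrite (leq_trans (size_polyD _ _)) // geq_max Sf.
have B k (f g : {poly R}) : (size f <= k)%N -> (size g <= k)%N -> (size (f - g)%R <= k)%N.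
  by move=> Sf Sg; apply: D; rewrite ?size_polyN.
have -> : (4 * d = d * 2 + d * 2)%N by rewrite -mulnDr mulnC.
rewrite /cubic_disc; apply: (B); last by apply/N/M; apply: E.
apply: (D); last by apply/N; rewrite -mulnDr (mulnDr d 3 1) muln1; apply: M => //; apply: E.
apply: (D); last by apply/N; rewrite -mulnDr (mulnDr d 1 3) muln1; apply: M => //; apply: E.
apply: (B); first by apply: M; apply: E.
have -> : (d * 2 + d * 2 = d + d + d + d)%N by rewrite muln2 -addnn !addnA.
by apply/N; do 3!apply: (M) => //.
Qed.

Section CubicDisc.
Variable K : numClosedFieldType.

(** The two equations are the partial derivatives of the binary cubic at [v], up to the factor 3.
    Once one root is split off, the discriminant is a square times the discriminant of the residual
    quadratic. *)
Lemma cubic_disc_double_root (b0 b1 b2 b3 : K) :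
  cubic_disc b0 b1 b2 b3 = 0 ->
  exists2 v : K * K, v != (0, 0) &
    v.1 ^+ 2 * b0 + 2%:R * v.1 * v.2 * b1 + v.2 ^+ 2 * b2 = 0 /\
    v.1 ^+ 2 * b1 + 2%:R * v.1 * v.2 * b2 + v.2 ^+ 2 * b3 = 0.
Proof.
rewrite /cubic_disc => D0.
have n2 : 2%:R != 0 :> K by rewrite pnatr_eq0.
have [b30|b3n0] := eqVneq b3 0.
  have /eqP : b2 ^+ 2 * (4%:R * b0 * b2 - 3%:R * b1 ^+ 2) = 0.
    by rewrite -[RHS]D0 b30; ring.
  have [b20 _|b2n0] := eqVneq b2 0.
    exists (0, 1); first by rewrite xpair_eqE oner_eq0 andbF.
    by rewrite /= b30 b20; split; ring.
  rewrite mulf_eq0 expf_eq0 (negPf b2n0) /= => /eqP E.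
  (* The double root of the residual quadratic [b0 v1^2 + 3 b1 v1 v2 + 3 b2 v2^2]. *)
  exists (- 2%:R * b2, b1).
    by rewrite xpair_eqE mulf_eq0 oppr_eq0 (negPf n2) (negPf b2n0).
  split; rewrite /= ?b30; last ring.
  by transitivity (b2 * (4%:R * b0 * b2 - 3%:R * b1 ^+ 2)); [ring | rewrite E mulr0].
pose p : {poly K} := \poly_(i < 4) [:: b0; 3%:R * b1; 3%:R * b2; b3]`_i.
have [y] : exists y, root p y.
  by apply/closed_rootP; rewrite size_poly_eq.
rewrite rootE horner_poly !big_ord_recr big_ord0 /= => /eqP py.
(* [c0, c1, c2, b3] are the coefficients after the substitution that moves the root [(1, y)] to
   [(1, 0)], which keeps the discriminant. *)
pose c1 := b1 + 2%:R * y * b2 + y ^+ 2 * b3; pose c2 := b2 + y * b3.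
pose c0 := b0 + 3%:R * y * b1 + 3%:R * y ^+ 2 * b2 + y ^+ 3 * b3.
have c00 : c0 = 0 by rewrite -[RHS]py /c0; ring.
have /eqP : c1 ^+ 2 * (4%:R * c1 * b3 - 3%:R * c2 ^+ 2) = 0.
  rewrite -[RHS]D0; apply/esym; transitivity (cubic_disc c0 c1 c2 b3).
    by rewrite /cubic_disc /c0 /c1 /c2; ring.
  by rewrite /cubic_disc c00; ring.
have [c10 _|c1n0] := eqVneq c1 0.
  exists (1, y); first by rewrite xpair_eqE oner_eq0.
  split; last by rewrite /= -[RHS]c10 /c1; ring.
  rewrite /=; transitivity (0 - y * c1); last by rewrite c10; ring.
  by rewrite -py /c1; ring.
rewrite mulf_eq0 expf_eq0 (negPf c1n0) /= => /eqP E.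
(* In the shifted coordinates this is [(c2, - 2 c1)], the double root of
   [3 c1 v1^2 + 3 c2 v1 v2 + b3 v2^2]. *)
exists (c2, y * c2 - 2%:R * c1).
  apply: contra c1n0; rewrite xpair_eqE /= => /andP[/eqP->].
  by rewrite mulr0 sub0r oppr_eq0 mulf_eq0 (negPf n2).
set w := y * c2 - _.
suff E2 : c2 ^+ 2 * b1 + 2%:R * c2 * w * b2 + w ^+ 2 * b3 = 0.
  split=> //=; transitivity
    (c2 ^+ 2 * c0 - y * (c2 ^+ 2 * b1 + 2%:R * c2 * w * b2 + w ^+ 2 * b3)).
    by rewrite /w /c0 /c1 /c2; ring.
  by rewrite c00 E2; ring.
transitivity (c1 * (4%:R * c1 * b3 - 3%:R * c2 ^+ 2)); last by rewrite E mulr0.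
by rewrite /w /c1 /c2; ring.
Qed.

(** Here and in the next three lemmas an identically zero discriminant has a vanishing lowest
    coefficient: [4 p0(0) b2(0)^3], then [(4 r0(0) b2(0) - 3 p1(0)^2) b2(0)^2]; for a triple root
    [p0(0)^2 b3(0)^2], then [4 p1(0)^3 b3(0)]. *)
Lemma cubic_disc_order_gt0 (p0 p1 b2 b3 : {poly K}) : b2.[0] != 0 ->
  cubic_disc ('X * p0) ('X * p1) b2 b3 = 0 -> p0.[0] = 0.
Proof.
move=> b2n0 /eqP.
rewrite (_ : cubic_disc _ _ _ _ = 'X * (4%:R%:P * p0 * b2 ^+ 3 +
  'X * (p0 ^+ 2 * b3 ^+ 2 - 6%:R * p0 * p1 * b2 * b3
  + 4%:R * 'X * p1 ^+ 3 * b3 - 3%:R * p1 ^+ 2 * b2 ^+ 2))); last first.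
  by rewrite /cubic_disc polyC_natr; ring.
rewrite mulf_eq0 polyX_eq0 /= => /eqP /(congr1 (fun p => p.[0])).
rewrite horner0 hornerD [('X * _).[0]]hornerM hornerX mul0r addr0.
rewrite !(horner_exp, hornerM, hornerC) => /eqP.
by rewrite mulf_eq0 expf_eq0 (negPf b2n0) orbF mulf_eq0 pnatr_eq0 => /eqP.
Qed.

Lemma cubic_disc_order_gt1 (r0 p1 b2 b3 : {poly K}) : b2.[0] != 0 ->
  cubic_disc ('X^2 * r0) ('X * p1) b2 b3 = 0 ->
  4%:R * r0.[0] * b2.[0] = 3%:R * p1.[0] ^+ 2.
Proof.
move=> b2n0 /eqP.
rewrite (_ : cubic_disc _ _ _ _ = 'X ^+ 2 *
  ((4%:R%:P * r0 * b2 - 3%:R%:P * p1 ^+ 2) * b2 ^+ 2 +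
  'X * ('X * r0 ^+ 2 * b3 ^+ 2 - 6%:R * r0 * p1 * b2 * b3
  + 4%:R * p1 ^+ 3 * b3))); last first.
  by rewrite /cubic_disc !polyC_natr; ring.
rewrite mulf_eq0 expf_eq0 polyX_eq0 /= => /eqP /(congr1 (fun p => p.[0])).
rewrite horner0 hornerD [('X * _).[0]]hornerM hornerX mul0r addr0.
rewrite [(_ * b2 ^+ 2).[0]]hornerM hornerD hornerN.
rewrite !(horner_exp, hornerM, hornerC) => /eqP.
by rewrite mulf_eq0 expf_eq0 (negPf b2n0) orbF subr_eq0 => /eqP.
Qed.

Lemma cubic_disc_order_triple (p0 p1 p2 b3 : {poly K}) : b3.[0] != 0 ->
  cubic_disc ('X * p0) ('X * p1) ('X * p2) b3 = 0 -> p0.[0] = 0.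
Proof.
move=> b3n0 /eqP.
rewrite (_ : cubic_disc _ _ _ _ = 'X ^+ 2 * (p0 ^+ 2 * b3 ^+ 2 +
  'X * (4%:R * 'X * p0 * p2 ^+ 3 - 6%:R * p0 * p1 * p2 * b3
  + 4%:R * p1 ^+ 3 * b3 - 3%:R * 'X * p1 ^+ 2 * p2 ^+ 2))); last first.
  by rewrite /cubic_disc; ring.
rewrite mulf_eq0 expf_eq0 polyX_eq0 /= => /eqP /(congr1 (fun p => p.[0])).
rewrite horner0 hornerD [('X * _).[0]]hornerM hornerX mul0r addr0.
rewrite !(horner_exp, hornerM) => /eqP.
by rewrite mulf_eq0 !expf_eq0 (negPf b3n0) orbF => /eqP.
Qed.

Lemma cubic_disc_order_triple_gt2 (r0 p1 p2 b3 : {poly K}) : b3.[0] != 0 ->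
  cubic_disc ('X^2 * r0) ('X * p1) ('X * p2) b3 = 0 -> p1.[0] = 0.
Proof.
move=> b3n0 /eqP.
rewrite (_ : cubic_disc _ _ _ _ = 'X ^+ 3 * (4%:R%:P * p1 ^+ 3 * b3 +
  'X * (r0 ^+ 2 * b3 ^+ 2 + 4%:R * 'X * r0 * p2 ^+ 3
   - 6%:R * r0 * p1 * p2 * b3 - 3%:R * p1 ^+ 2 * p2 ^+ 2))); last first.
  by rewrite /cubic_disc polyC_natr; ring.
rewrite mulf_eq0 expf_eq0 polyX_eq0 /= => /eqP /(congr1 (fun p => p.[0])).
rewrite horner0 hornerD [('X * _).[0]]hornerM hornerX mul0r addr0.
rewrite !(horner_exp, hornerM, hornerC) => /eqP.
by rewrite mulf_eq0 (negPf b3n0) orbF mulf_eq0 pnatr_eq0 expf_eq0 => /eqP.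
Qed.

Lemma dvdp_cubic_disc_double (p q r s : {poly K}) :
  'X^2 %| cubic_disc ('X^2 * p) ('X * q) r s.
Proof.
apply/dvdpP; exists ('X^2 * p ^+ 2 * s ^+ 2 - 6%:R * 'X * p * q * r * s
  + 4%:R * p * r ^+ 3 + 4%:R * 'X * q ^+ 3 * s - 3%:R * q ^+ 2 * r ^+ 2).
by rewrite /cubic_disc; ring.
Qed.

Lemma dvdp_cubic_disc_vertical (p q r s : {poly K}) :
  'X^4 %| cubic_disc ('X * p) ('X * q) ('X * r) ('X * s).
Proof.
by apply/dvdpP; exists (cubic_disc p q r s); rewrite /cubic_disc; ring.
Qed.

End CubicDisc.

(** * Symmetric trilinear forms *)

Definition vanishing (U V : Type) (K : nmodType) (T : U -> U -> V -> K) (x : U) :=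
  forall y, T x x y = 0.

Section TrilinearForm.
Variables (K : comPzRingType) (V : lmodType K) (T : V -> V -> V -> K).
Hypothesis T_lin : forall a x x' y z, T (a *: x + x') y z = a * T x y z + T x' y z.
Hypothesis T12 : forall x y z, T x y z = T y x z.
Hypothesis T23 : forall x y z, T x y z = T x z y.

Lemma trilinD1 x x' y z : T (x + x') y z = T x y z + T x' y z.
Proof. by rewrite -{1}[x]scale1r T_lin mul1r. Qed.
Lemma trilinD2 x y y' z : T x (y + y') z = T x y z + T x y' z.
Proof. by rewrite !(T12 x) trilinD1. Qed.
Lemma trilinD3 x y z z' : T x y (z + z') = T x y z + T x y z'.
Proof. by rewrite !(T23 x y) trilinD2. Qed.
Lemma trilin0 y z : T 0 y z = 0.
Proof. by apply: (addrI (T 0 y z)); rewrite -trilinD1 !addr0. Qed.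
Lemma trilinZ1 a x y z : T (a *: x) y z = a * T x y z.
Proof. by rewrite -[a *: x]addr0 T_lin trilin0 addr0. Qed.
Lemma trilinZ2 a x y z : T x (a *: y) z = a * T x y z.
Proof. by rewrite !(T12 x) trilinZ1. Qed.
Lemma trilinZ3 a x y z : T x y (a *: z) = a * T x y z.
Proof. by rewrite !(T23 x y) trilinZ2. Qed.

Definition trilinE := (trilinD1, trilinD2, trilinD3, trilinZ1, trilinZ2, trilinZ3).

End TrilinearForm.

(** * Hyperbolic frames at a node *)

Section NodalForm.
Variable K : numClosedFieldType.
Notation V := 'rV[K]_5.
Variable T : V -> V -> V -> K.
Hypothesis T_lin : forall a x x' y z, T (a *: x + x') y z = a * T x y z + T x' y z.
Hypothesis T12 : forall x y z, T x y z = T y x z.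
Hypothesis T23 : forall x y z, T x y z = T x z y.
Let T01 := trilin0 T_lin.
Let TE := trilinE T_lin T12 T23.

Variable P : V.
Hypothesis P_sing : vanishing T P.
Hypothesis nodal : forall x, x != 0 -> vanishing T x ->
  forall z, (forall y, T x z y = 0) -> exists c, z = c *: x.

(** In coordinates modulo [P] the form [T P x x] is [2 k (c1 c4 - c2 c3)], a multiple of the
    determinant of the matrix with rows [(c1, c2)] and [(c3, c4)]. The scalar [k] varies because
    exchanging columns changes the sign. *)
Record frame (e1 e2 e3 e4 : V) (k : K) : Prop := Frame {
  fr_k : k != 0;
  fr11 : T P e1 e1 = 0; fr12 : T P e1 e2 = 0; fr13 : T P e1 e3 = 0;
  fr14 : T P e1 e4 = k; fr22 : T P e2 e2 = 0; fr23 : T P e2 e3 = - k;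
  fr24 : T P e2 e4 = 0; fr33 : T P e3 e3 = 0; fr34 : T P e3 e4 = 0;
  fr44 : T P e4 e4 = 0;
  fr_span : forall x, exists c0 c1 c2 c3 c4 : K,
    x = c0 *: P + (c1 *: e1 + c2 *: e2 + (c3 *: e3 + c4 *: e4)) }.

(** Puts the arguments of [T] in a fixed order, so that [ring] sees symmetric values as one atom. *)
Ltac sortT x y :=
  repeat match goal with
  | |- context [T y x ?z] => rewrite (T12 y x z)
  | |- context [T ?z y x] => rewrite (T23 z y x)
  end.
Ltac sort5 a b c d e :=
  do 3 (sortT a b; sortT a c; sortT a d; sortT a e; sortT b c; sortT b d; sortT b e;
  sortT c d; sortT c e; sortT d e).

(** A row operation on the coordinate matrix keeps the determinant; it moves the fibre at parameter
    [x] of the first P^1 to parameter 0. *)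
Lemma frame_shear (x : K) e1 e2 e3 e4 k :
  frame e1 e2 e3 e4 k -> frame (e1 + x *: e3) (e2 + x *: e4) e3 e4 k.
Proof.
case=> k0 h11 h12 h13 h14 h22 h23 h24 h33 h34 h44 sp.
split=> //; rewrite ?TE; sort5 P e1 e2 e3 e4;
  rewrite ?(h11, h12, h13, h14, h22, h23, h24, h33, h34, h44); try ring.
move=> y; have [c0 [c1 [c2 [c3 [c4 ->]]]]] := sp y.
exists c0, c1, c2, (c3 - c1 * x), (c4 - c2 * x).
by apply/rowP=> j; rewrite !mxE; ring.
Qed.

Lemma frame_transpose e1 e2 e3 e4 k : frame e1 e2 e3 e4 k -> frame e1 e3 e2 e4 k.
Proof.
case=> k0 h11 h12 h13 h14 h22 h23 h24 h33 h34 h44 sp.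
split=> //; first by rewrite T23.
move=> y; have [c0 [c1 [c2 [c3 [c4 ->]]]]] := sp y; exists c0, c1, c3, c2, c4.
by rewrite -!addrA; do 2!congr (_ + _); rewrite addrCA.
Qed.

Lemma frame_shear_tr (y : K) e1 e2 e3 e4 k :
  frame e1 e2 e3 e4 k -> frame (e1 + y *: e2) e2 (e3 + y *: e4) e4 k.
Proof. by move/frame_transpose/(frame_shear y)/frame_transpose. Qed.

Lemma frame_swap e1 e2 e3 e4 k : frame e1 e2 e3 e4 k -> frame e2 e1 e4 e3 (- k).
Proof.
case=> k0 h11 h12 h13 h14 h22 h23 h24 h33 h34 h44 sp.
split=> //; rewrite ?oppr_eq0 ?opprK // 1?T23 //.
move=> y; have [c0 [c1 [c2 [c3 [c4 ->]]]]] := sp y; exists c0, c2, c1, c4, c3.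
by congr (_ + (_ + _)); rewrite addrC.
Qed.

Lemma frame_ext e1 e2 e3 e4 k x z : frame e1 e2 e3 e4 k ->
  T x z P = 0 -> T x z e1 = 0 -> T x z e2 = 0 -> T x z e3 = 0 -> T x z e4 = 0 ->
  forall y, T x z y = 0.
Proof.
move=> fr h0 h1 h2 h3 h4 y; have [c0 [c1 [c2 [c3 [c4 ->]]]]] := fr_span fr y.
by rewrite !TE h0 h1 h2 h3 h4; ring.
Qed.

(** In the chart [e1 + t e3 + y (e2 + t e4)] the quadratic part of the curve at [e1] is, up to the
    factor 3, [T e1 e3 e3 t^2 + (2 T e1 e2 e3 + T e1 e1 e4) t y + T e1 e2 e2 y^2]. If it were
    degenerate, a kernel vector would lift to the radical at a singular point of the cubic, against
    [nodal]. *)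
Lemma frame_node_nondegenerate e1 e2 e3 e4 k : frame e1 e2 e3 e4 k ->
  T e1 e1 e1 = 0 -> T e1 e1 e2 = 0 -> T e1 e1 e3 = 0 ->
  (2%:R * T e1 e2 e3 + T e1 e1 e4) ^+ 2 != 4%:R * (T e1 e2 e2 * T e1 e3 e3).
Proof.
move=> fr t111 t112 t113; apply/negP => /eqP E.
set m := 2%:R * _ + _ in E.
have [[al be] /= ab0 [E1 E2]] : exists2 ab : K * K, ab != (0, 0) &
    2%:R * ab.1 * T e1 e2 e2 + ab.2 * m = 0 /\ ab.1 * m + 2%:R * ab.2 * T e1 e3 e3 = 0.
  have [/eqP m0|m0] := boolP (m == 0); last first.
    exists (m, - 2%:R * T e1 e2 e2); first by rewrite xpair_eqE negb_and m0.
    by split => /=; [ring | rewrite -expr2 E; ring].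
  have [/eqP t0|t0] := boolP (T e1 e2 e2 == 0).
    by exists (1, 0); [rewrite xpair_eqE oner_eq0 | rewrite /= t0 m0; split; ring].
  exists (0, 1); first by rewrite xpair_eqE oner_eq0 andbF.
  split; rewrite /= m0; first by ring.
  move/eqP: E; rewrite m0 expr0n /= eq_sym !mulf_eq0 (negPf t0) pnatr_eq0 /=.
  by move/eqP->; ring.
have k0 := fr_k fr.
have n2 : 2%:R != 0 :> K by rewrite pnatr_eq0.
(* [c] makes [T x x e4] vanish for [x = c P + e1], and [s] makes [T x z e4] vanish for the lifted
   kernel vector [z]. *)
pose c := - T e1 e1 e4 / (2%:R * k).
pose s := - (al * T e1 e2 e4 + be * T e1 e3 e4) / k.
case: (fr) => _ h11 h12 h13 h14 h22 h23 h24 h33 h34 h44 _.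
have x0 : c *: P + e1 != 0.
  apply/eqP => /(congr1 (fun x => T P x e4)).
  by rewrite !TE P_sing h14 mulr0 add0r T12 T01 => /eqP; rewrite (negPf k0).
have h := (P_sing, h11, h12, h13, h14, h22, h23, h24, h33, h34, h44).
have xS : vanishing T (c *: P + e1).
  apply: (frame_ext fr); rewrite !TE; sort5 P e1 e2 e3 e4;
    rewrite ?h ?t111 ?t112 ?t113 ?/c; try by ring.
  by field.
have [] := nodal x0 xS (z := s *: P + (al *: e2 + be *: e3)).
  apply: (frame_ext fr); rewrite !TE; sort5 P e1 e2 e3 e4;
    rewrite ?h ?t112 ?t113; try by ring.
  - apply: (mulfI n2); rewrite [RHS]mulr0 -[RHS]E1 /m /c; by field.
  - apply: (mulfI n2); rewrite [RHS]mulr0 -[RHS]E2 /m /c; by field.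
  - by rewrite /s; field.
move=> d Ed; move: ab0.
(* Pairing with [e3] and [e2] under [T P] kills the multiples of [c P + e1] and isolates [al] and
   [be]. *)
have := congr1 (fun x => T P x e3) Ed; have := congr1 (fun x => T P x e2) Ed.
rewrite !TE; sort5 P e1 e2 e3 e4; rewrite ?h !(mulr0, add0r, addr0) => /eqP.
rewrite mulrN oppr_eq0 mulf_eq0 (negPf k0) orbF => /eqP-> /eqP.
by rewrite mulrN oppr_eq0 mulf_eq0 (negPf k0) orbF => /eqP->; rewrite eqxx.
Qed.

(** * The curve of bidegree (3,3) and its fibre discriminant *)

Definition tpoly (a a' b b' c c' : V) : {poly K} :=
  (T a b c)%:P + (T a' b c + T a b' c + T a b c')%:P * 'X
  + (T a' b' c + T a' b c' + T a b' c')%:P * 'X^2 + (T a' b' c')%:P * 'X^3.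

Lemma horner_tpoly a a' b b' c c' x :
  (tpoly a a' b b' c c').[x] = T (a + x *: a') (b + x *: b') (c + x *: c').
Proof. by rewrite /tpoly !(hornerD, hornerM, hornerC, hornerX, hornerXn) !TE; ring. Qed.

Lemma size_tpoly a a' b b' c c' : (size (tpoly a a' b b' c c') <= 4)%N.
Proof.
rewrite /tpoly !mul_polyC.
do 3!(apply: leq_trans (size_polyD _ _) _; rewrite geq_max; apply/andP; split;
  last by rewrite (leq_trans (size_scale_leq _ _)) // ?size_polyXn ?size_polyX).
exact: leq_trans (size_polyC_leq1 _) _.
Qed.

(** The fibre over [t] is the binary cubic given by [T] on the span of [e1 + t e3] and [e2 + t e4];
    this is its discriminant as a polynomial in [t]. *)
Definition fiber_disc e1 e2 e3 e4 := cubic_disc (tpoly e1 e3 e1 e3 e1 e3)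
  (tpoly e1 e3 e1 e3 e2 e4) (tpoly e1 e3 e2 e4 e2 e4) (tpoly e2 e4 e2 e4 e2 e4).

Lemma horner_fiber_disc e1 e2 e3 e4 x :
  let A := e1 + x *: e3 in let B := e2 + x *: e4 in
  (fiber_disc e1 e2 e3 e4).[x] = cubic_disc (T A A A) (T A A B) (T A B B) (T B B B).
Proof.
rewrite /= -[LHS]/(horner_eval x _) rmorph_cubic_disc /horner_eval.
by congr cubic_disc; apply: horner_tpoly.
Qed.

Lemma size_fiber_disc e1 e2 e3 e4 : (size (fiber_disc e1 e2 e3 e4) <= 13)%N.
Proof.
by apply: (size_cubic_disc (d := 3)); apply: size_tpoly.
Qed.

Lemma fiber_disc_shear x e1 e2 e3 e4 :
  fiber_disc (e1 + x *: e3) (e2 + x *: e4) e3 e4 = fiber_disc e1 e2 e3 e4 \Po ('X + x%:P).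
Proof.
apply: horner_inj => y; rewrite horner_comp.
have -> : ('X + x%:P).[y] = y + x by rewrite hornerD hornerX hornerC.
rewrite !horner_fiber_disc.
by rewrite /= -!addrA -!scalerDl [x + y]addrC.
Qed.

(** On each fibre [A] becomes [A + y B], a unipotent substitution in the binary cubic, which
    preserves the discriminant. *)
Lemma fiber_disc_shear_tr y e1 e2 e3 e4 :
  fiber_disc (e1 + y *: e2) e2 (e3 + y *: e4) e4 = fiber_disc e1 e2 e3 e4.
Proof.
have inv A B : cubic_disc (T (A + y *: B) (A + y *: B) (A + y *: B))
    (T (A + y *: B) (A + y *: B) B) (T (A + y *: B) B B) (T B B B) =
    cubic_disc (T A A A) (T A A B) (T A B B) (T B B B).
  by rewrite !TE; sortT A B; rewrite /cubic_disc; ring.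
apply: horner_inj => x; rewrite !horner_fiber_disc /= -[RHS]inv.
suff -> : e1 + y *: e2 + x *: (e3 + y *: e4) = e1 + x *: e3 + y *: (e2 + x *: e4) by [].
by apply/rowP=> j; rewrite !mxE; ring.
Qed.

Lemma fiber_disc_swap e1 e2 e3 e4 : fiber_disc e2 e1 e4 e3 = fiber_disc e1 e2 e3 e4.
Proof.
have inv A B : cubic_disc (T B B B) (T B B A) (T B A A) (T A A A) =
    cubic_disc (T A A A) (T A A B) (T A B B) (T B B B).
  by sortT A B; rewrite /cubic_disc; ring.
by apply: horner_inj => x; rewrite !horner_fiber_disc /= inv.
Qed.

Lemma dvdp_fiber_disc_shear t k e1 e2 e3 e4 :
  'X^k %| fiber_disc (e1 + t *: e3) (e2 + t *: e4) e3 e4 ->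
  ('X - t%:P) ^+ k %| fiber_disc e1 e2 e3 e4.
Proof.
move=> /(dvdp_comp_poly ('X - t%:P)); rewrite comp_Xn_poly fiber_disc_shear.
rewrite -comp_polyA.
suff -> : ('X + t%:P) \Po ('X - t%:P) = 'X by rewrite comp_polyXr.
by rewrite comp_polyD comp_polyX comp_polyC subrK.
Qed.

(** [B] and [e3 + y e4] are the derivatives of [a] in [y] and in [t], so the conditions say that the
    curve is singular at [(t, y)]. *)
Definition fiber_node e1 e2 e3 e4 t y :=
  let B := e2 + t *: e4 in let a := e1 + t *: e3 + y *: B in
  [/\ T a a a = 0, T a a B = 0 & T a a (e3 + y *: e4) = 0].

Definition vertical e1 e2 e3 e4 t :=
  let A := e1 + t *: e3 in let B := e2 + t *: e4 in
  [&& T A A A == 0, T A A B == 0, T A B B == 0 & T B B B == 0].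

(** With the point moved to the origin, the first coefficient of the binary cubic is divisible by
    ['X^2] and the second by ['X]; every term of the discriminant then has order at least 2. *)
Lemma fiber_node_dvdp e1 e2 e3 e4 t y : fiber_node e1 e2 e3 e4 t y ->
  ('X - t%:P) ^+ 2 %| fiber_disc e1 e2 e3 e4.
Proof.
move=> [t1 t2 t3]; apply: dvdp_fiber_disc_shear.
rewrite -(fiber_disc_shear_tr y); move: t1 t2 t3.
move: (e3 + y *: e4) (e1 + t *: e3 + y *: (e2 + t *: e4)) => f3 f1.
move: (e2 + t *: e4) => f2 t1 t2 t3; rewrite /fiber_disc.
have -> : tpoly f1 f3 f1 f3 f1 f3
    = 'X^2 * ((3%:R * T f1 f3 f3)%:P + (T f3 f3 f3)%:P * 'X).
  by rewrite /tpoly; sortT f1 f3; rewrite t1 t3 !polyCD polyCM polyC_natr; ring.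
have -> : tpoly f1 f3 f1 f3 f2 e4 = 'X * ((T f3 f1 f2 + T f1 f3 f2 + T f1 f1 e4)%:P +
    (T f3 f3 f2 + T f3 f1 e4 + T f1 f3 e4)%:P * 'X + (T f3 f3 e4)%:P * 'X^2).
  by rewrite /tpoly t2; ring.
exact: dvdp_cubic_disc_double.
Qed.

(** All four coefficients vanish at [t], and the discriminant is homogeneous of degree 4 in them. *)
Lemma vertical_dvdp e1 e2 e3 e4 t : vertical e1 e2 e3 e4 t ->
  ('X - t%:P) ^+ 4 %| fiber_disc e1 e2 e3 e4.
Proof.
move=> /and4P[/eqP t1 /eqP t2 /eqP t3 /eqP t4]; apply: dvdp_fiber_disc_shear.
move: (e1 + t *: e3) (e2 + t *: e4) t1 t2 t3 t4 => f1 f2 t1 t2 t3 t4; rewrite /fiber_disc.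
have tX a a' b b' c c' : T a b c = 0 -> exists q, tpoly a a' b b' c c' = 'X * q.
  move=> t0; exists ((T a' b c + T a b' c + T a b c')%:P +
    (T a' b' c + T a' b c' + T a b' c')%:P * 'X + (T a' b' c')%:P * 'X^2).
  by rewrite /tpoly t0; ring.
have [p ->] := tX f1 e3 f1 e3 f1 e3 t1; have [q ->] := tX f1 e3 f1 e3 f2 e4 t2.
have [r ->] := tX f1 e3 f2 e4 f2 e4 t3; have [s ->] := tX f2 e4 f2 e4 f2 e4 t4.
exact: dvdp_cubic_disc_vertical.
Qed.

(** A nonzero binary cubic cannot have two distinct multiple roots. *)
Lemma fiber_node_vertical e1 e2 e3 e4 t y y' : y != y' ->
  fiber_node e1 e2 e3 e4 t y -> fiber_node e1 e2 e3 e4 t y' -> vertical e1 e2 e3 e4 t.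
Proof.
move=> ny; rewrite /fiber_node /vertical /=.
move: (e1 + t *: e3) (e2 + t *: e4) => A B [t1 t2 _] [t1' t2' _].
have ny0 : y' - y != 0 by rewrite subr_eq0 eq_sym.
move: t1 t2 t1' t2'; rewrite !TE; sortT A B.
move: (T A A A) (T A A B) (T A B B) (T B B B) => b0 b1 b2 b3 E1 E2 E1' E2'.
have n2 : 2%:R != 0 :> K by rewrite pnatr_eq0.
(* [f] and [g] are the partial derivatives of the binary cubic, up to the factor 3; both vanish at
   [y] and [y']. *)
pose g z := b1 + z * b2 + (z * b2 + z * (z * b3)).
pose f z := b0 + z * b1 + (z * b1 + z * (z * b2)).
have fE z : g z = 0 -> f z + z * g z = 0 -> f z = 0.
  by move=> ->; rewrite mulr0 addr0.
have Eg : g y = 0 by rewrite -[RHS]E2 /g; ring.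
have Eg' : g y' = 0 by rewrite -[RHS]E2' /g; ring.
have G : f y = 0 by apply: (fE _ Eg); rewrite -[RHS]E1 /f /g; ring.
have G' : f y' = 0 by apply: (fE _ Eg'); rewrite -[RHS]E1' /f /g; ring.
have h2 : 2%:R * b2 + (y + y') * b3 = 0.
  apply: (mulfI ny0); transitivity (g y' - g y); first by rewrite /g; ring.
  by rewrite Eg Eg' subrr mulr0.
have h1 : 2%:R * b1 + (y + y') * b2 = 0.
  apply: (mulfI ny0); transitivity (f y' - f y); first by rewrite /f; ring.
  by rewrite G G' subrr mulr0.
have /eqP : b3 * (y' - y) ^+ 2 = 0.
  transitivity (4%:R * g y - 2%:R * (2%:R * b1 + (y + y') * b2)
    + (y + y') * (2%:R * b2 + (y + y') * b3)
    - 4%:R * y * (2%:R * b2 + (y + y') * b3)); first by rewrite /g; ring.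
  by rewrite Eg h1 h2; ring.
rewrite mulf_eq0 expf_eq0 (negPf ny0) orbF => /eqP b30.
move: h2; rewrite b30 mulr0 addr0 => /eqP; rewrite mulf_eq0 (negPf n2) => /eqP b20.
move: h1; rewrite b20 mulr0 addr0 => /eqP; rewrite mulf_eq0 (negPf n2) => /eqP b10.
by move: G; rewrite /f b10 b20 !(mulr0, addr0) => ->; rewrite eqxx.
Qed.

(** * Nonvanishing of the discriminant *)

(** Here [e1] is a multiple root of the fibre over 0. If the discriminant were zero, its lowest
    coefficient would give [T e1 e1 e3 = 0], a singular point of the curve at [e1], and the next one
    would make the quadratic part there degenerate. *)
Lemma fiber_disc_neq0_at_double e1 e2 e3 e4 k : frame e1 e2 e3 e4 k ->
  T e1 e1 e1 = 0 -> T e1 e1 e2 = 0 -> (T e1 e2 e2 != 0) || (T e2 e2 e2 != 0) ->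
  fiber_disc e1 e2 e3 e4 != 0.
Proof.
move=> fr t111 t112 nz; apply/negP => /eqP; rewrite /fiber_disc.
pose q0 := (3%:R * T e1 e3 e3)%:P + (T e3 e3 e3)%:P * 'X.
pose p0 := (3%:R * T e1 e1 e3)%:P + 'X * q0.
pose p1 := (2%:R * T e1 e2 e3 + T e1 e1 e4)%:P +
    (T e3 e3 e2 + T e3 e1 e4 + T e1 e3 e4)%:P * 'X + (T e3 e3 e4)%:P * 'X^2.
have -> : tpoly e1 e3 e1 e3 e1 e3 = 'X * p0.
  rewrite /tpoly /p0 /q0; sortT e1 e3; rewrite t111 !polyCD !polyCM !polyC_natr.
  by ring.
have -> : tpoly e1 e3 e1 e3 e2 e4 = 'X * p1.
  rewrite /tpoly /p1; sortT e1 e3; sortT e2 e3.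
  by rewrite t112 !polyCD !polyCM !polyC_natr; ring.
have n3 : 3%:R != 0 :> K by rewrite pnatr_eq0.
have p00 : p0.[0] = 3%:R * T e1 e1 e3.
  by rewrite /p0 hornerD hornerC [('X * _).[0]]hornerM hornerX mul0r addr0.
have q00 : q0.[0] = 3%:R * T e1 e3 e3.
  by rewrite /q0 hornerD hornerC [(_ * 'X).[0]]hornerM hornerX mulr0 addr0.
have p10 : p1.[0] = 2%:R * T e1 e2 e3 + T e1 e1 e4.
  by rewrite /p1 !(hornerD, hornerXn, hornerM, hornerC, hornerX) ?expr0n !(mulr0, addr0).
have step : p0.[0] = 0 -> T e1 e1 e3 = 0 /\ 'X * p0 = 'X^2 * q0.
  rewrite p00 => /eqP; rewrite mulf_eq0 (negPf n3) => /eqP t113; split=> //.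
  by rewrite /p0 t113 mulr0 add0r mulrA.
(* The root has multiplicity exactly two when [T e1 e2 e2] is nonzero. Otherwise it is triple, and
   orders 2 and 3 take the place of orders 1 and 2. *)
have [t122|t122] := eqVneq (T e1 e2 e2) 0; last first.
  move: (tpoly e2 e4 e2 e4 e2 e4) => b3.
  have : (tpoly e1 e3 e2 e4 e2 e4).[0] != 0 by rewrite horner_tpoly !scale0r !addr0.
  have : (tpoly e1 e3 e2 e4 e2 e4).[0] = T e1 e2 e2 by rewrite horner_tpoly !scale0r !addr0.
  move: (tpoly e1 e3 e2 e4 e2 e4) => b2 b20 b2n0 D0.
  have [t113 Ep] := step (cubic_disc_order_gt0 b2n0 D0).
  rewrite Ep in D0; have := cubic_disc_order_gt1 b2n0 D0.
  rewrite q00 p10 b20 => E.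
  have /negP := frame_node_nondegenerate fr t111 t112 t113; apply; apply/eqP.
  by apply: (mulfI n3); rewrite -E; ring.
move: nz; rewrite t122 eqxx /= => t222.
have : (tpoly e2 e4 e2 e4 e2 e4).[0] != 0 by rewrite horner_tpoly !scale0r !addr0.
move: (tpoly e2 e4 e2 e4 e2 e4) => b3 b3n0.
have -> : tpoly e1 e3 e2 e4 e2 e4 = 'X * ((T e3 e2 e2 + T e1 e4 e2 + T e1 e2 e4)%:P +
    (T e3 e4 e2 + T e3 e2 e4 + T e1 e4 e4)%:P * 'X + (T e3 e4 e4)%:P * 'X^2).
  by rewrite /tpoly t122; ring.
move=> D0; have [t113 Ep] := step (cubic_disc_order_triple b3n0 D0).
rewrite Ep in D0; have := cubic_disc_order_triple_gt2 b3n0 D0; rewrite p10 => E.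
have /negP := frame_node_nondegenerate fr t111 t112 t113; apply.
by rewrite E t122 !mul0r mulr0 expr0n.
Qed.

(** A zero discriminant yields a multiple root over 0, which a change of frame keeping the
    discriminant brings to [e1]. *)
Lemma fiber_disc_neq0_at0 e1 e2 e3 e4 k : frame e1 e2 e3 e4 k ->
  ~~ vertical e1 e2 e3 e4 0 -> fiber_disc e1 e2 e3 e4 != 0.
Proof.
move=> fr; rewrite /vertical !scale0r !addr0 => nv; apply/negP => D0.
have : (fiber_disc e1 e2 e3 e4).[0] = 0 by rewrite (eqP D0) horner0.
rewrite horner_fiber_disc /= !scale0r !addr0 => /cubic_disc_double_root[[v w] /= vw0 [E1 E2]].
(* The root is [e2] when [v = 0], and exchanging [e1] and [e2] applies; otherwise it is [e1 + y e2],
   and a shear applies. *)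
have [v0|v0] := eqVneq v 0.
  move: vw0 E1 E2; rewrite v0 xpair_eqE eqxx /= => w0.
  rewrite expr0n !(mulr0, mul0r) !add0r => /eqP.
  rewrite mulf_eq0 expf_eq0 (negPf w0) andbF => /eqP t122 /eqP.
  rewrite mulf_eq0 expf_eq0 (negPf w0) andbF => /eqP t222.
  have t221 : T e2 e2 e1 = 0 by sortT e1 e2.
  have := fiber_disc_neq0_at_double (frame_swap fr) t222 t221.
  rewrite fiber_disc_swap D0 => H; apply: notF; apply: H.
  move: nv; rewrite t122 t222 eqxx /= !andbT negb_and orbC.
  by sortT e1 e2.
pose y := w / v; have wE : w = v * y by rewrite /y mulrC divfK.
have vv0 : v ^+ 2 != 0 by rewrite expf_eq0 (negPf v0) andbF.
have F1 : T e1 e1 e1 + 2%:R * y * T e1 e1 e2 + y ^+ 2 * T e1 e2 e2 = 0.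
  by apply: (mulfI vv0); rewrite mulr0 -[RHS]E1 wE; ring.
have F2 : T e1 e1 e2 + 2%:R * y * T e1 e2 e2 + y ^+ 2 * T e2 e2 e2 = 0.
  by apply: (mulfI vv0); rewrite mulr0 -[RHS]E2 wE; ring.
have := fiber_disc_neq0_at_double (frame_shear_tr y fr).
rewrite fiber_disc_shear_tr D0 => H; apply: notF; apply: H.
- rewrite !TE; sortT e1 e2.
  transitivity (T e1 e1 e1 + 2%:R * y * T e1 e1 e2 + y ^+ 2 * T e1 e2 e2
    + y * (T e1 e1 e2 + 2%:R * y * T e1 e2 e2 + y ^+ 2 * T e2 e2 e2)); first by ring.
  by rewrite F1 F2 mulr0 addr0.
- by rewrite !TE; sortT e1 e2; rewrite -[RHS]F2; ring.
- rewrite -negb_and; apply: contra nv => /andP[]; rewrite !TE => /eqP t122 /eqP t222.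
  move: t122; rewrite t222 mulr0 addr0 => t122.
  move: F1 F2; rewrite t122 t222 !mulr0 !addr0 => F1 t112.
  by move: F1; rewrite t112 mulr0 addr0 => ->; rewrite !eqxx.
Qed.

(** Otherwise the curve would be all of P^1 x P^1, hence singular at [e1] with a degenerate
    quadratic part. *)
Lemma fiber_coefs_neq0 e1 e2 e3 e4 k : frame e1 e2 e3 e4 k ->
  has (fun p => p != 0) [:: tpoly e1 e3 e1 e3 e1 e3; tpoly e1 e3 e1 e3 e2 e4;
    tpoly e1 e3 e2 e4 e2 e4; tpoly e2 e4 e2 e4 e2 e4].
Proof.
move=> fr; apply/negPn; rewrite -all_predC /=.
apply/negP => /and5P[/negPn/eqP p0 /negPn/eqP p1 /negPn/eqP p2 _ _].
have n3 : 3%:R != 0 :> K by rewrite pnatr_eq0.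
have c0 a a' b b' c c' : tpoly a a' b b' c c' = 0 -> T a b c = 0.
  by move=> /(congr1 (fun p => p.[0])); rewrite horner_tpoly horner0 !scale0r !addr0.
have c1 a a' b b' c c' : tpoly a a' b b' c c' = 0 -> T a' b c + T a b' c + T a b c' = 0.
  move=> /(congr1 (coefp 1)); rewrite /coefp /tpoly !coefD !coefMXn !coefMX !coefC /=.
  by rewrite !(addr0, add0r).
have t113 : T e1 e1 e3 = 0.
  by apply: (mulfI n3); rewrite mulr0 -[RHS](c1 _ _ _ _ _ _ p0); sortT e1 e3; ring.
have := frame_node_nondegenerate fr (c0 _ _ _ _ _ _ p0) (c0 _ _ _ _ _ _ p1) t113.
rewrite (c0 _ _ _ _ _ _ p2) mul0r mulr0 expf_eq0 /=.
suff -> : 2%:R * T e1 e2 e3 + T e1 e1 e4 = 0 by rewrite eqxx.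
by rewrite -[RHS](c1 _ _ _ _ _ _ p1); sortT e1 e3; sortT e2 e3; ring.
Qed.

Lemma verticalE e1 e2 e3 e4 t : vertical e1 e2 e3 e4 t =
  all (root^~ t) [:: tpoly e1 e3 e1 e3 e1 e3; tpoly e1 e3 e1 e3 e2 e4;
    tpoly e1 e3 e2 e4 e2 e4; tpoly e2 e4 e2 e4 e2 e4].
Proof. by rewrite /= !rootE !horner_tpoly andbT. Qed.

Lemma fiber_disc_neq0 e1 e2 e3 e4 k : frame e1 e2 e3 e4 k -> fiber_disc e1 e2 e3 e4 != 0.
Proof.
move=> fr; have /hasP[p ps /closed_nonrootP[t nt]] := fiber_coefs_neq0 fr.
have : ~~ vertical e1 e2 e3 e4 t by rewrite verticalE; apply/allPn; exists p.
have := fiber_disc_neq0_at0 (frame_shear t fr).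
rewrite /vertical !scale0r !addr0 fiber_disc_shear => H /H.
by apply: contra => /eqP->; rewrite comp_poly0.
Qed.

(** * Counting the singular points of the curve *)

Lemma size_verticals e1 e2 e3 e4 k (ts : seq K) : frame e1 e2 e3 e4 k ->
  uniq ts -> all (vertical e1 e2 e3 e4) ts -> (size ts <= 3)%N.
Proof.
move=> fr Us Vs; have /hasP[p ps p0] := fiber_coefs_neq0 fr.
rewrite -ltnS (leq_trans (max_poly_roots p0 _ Us)) //.
  by apply: sub_all Vs => t; rewrite verticalE => /allP; apply.
by move: ps; rewrite !inE => /or4P[] /eqP->; apply: size_tpoly.
Qed.

(** Along a contained line the derivative in [t] is the polynomial [tpoly f1 f2 f1 f2 e3 e4] in [y],
    of degree at most 3. Were it zero, the curve would have a degenerate singular point at [f1]. *)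
Lemma vertical_fiber_size e1 e2 e3 e4 k t (ys : seq K) : frame e1 e2 e3 e4 k ->
  vertical e1 e2 e3 e4 t -> uniq ys -> (forall y, y \in ys -> fiber_node e1 e2 e3 e4 t y) ->
  (size ys <= 3)%N.
Proof.
move=> /(frame_shear t); rewrite /vertical /fiber_node /=.
move: (e1 + t *: e3) (e2 + t *: e4) => f1 f2 fr.
move=> /and4P[/eqP t111 /eqP t112 /eqP t122 /eqP t222] Us N.
have p0 : tpoly f1 f2 f1 f2 e3 e4 != 0.
  apply/eqP => p0; have := frame_node_nondegenerate fr t111 t112.
  have -> : T f1 f1 e3 = 0.
    have := congr1 (fun p => p.[0]) p0.
    by rewrite horner_tpoly horner0 !scale0r !addr0.
  rewrite t122 mul0r mulr0 expf_eq0 /= => /(_ erefl) /negP; apply.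
  have := congr1 (coefp 1) p0.
  rewrite /coefp /tpoly !coefD !coefMXn !coefMX !coefC /= !(addr0, add0r).
  by move=> <-; apply/eqP; sortT f1 f2; ring.
rewrite -ltnS (leq_trans (max_poly_roots p0 _ Us)) ?size_tpoly //.
by apply/allP => y /N[_ _]; rewrite rootE horner_tpoly => ->.
Qed.

Lemma fiber_nodes_size e1 e2 e3 e4 k (s : seq (K * K)) : frame e1 e2 e3 e4 k ->
  uniq s -> (forall p, p \in s -> fiber_node e1 e2 e3 e4 p.1 p.2) -> (size s <= 9)%N.
Proof.
move=> fr Us N; pose V := vertical e1 e2 e3 e4.
pose ts := undup [seq p.1 | p <- s]; have Ut : uniq ts by apply: undup_uniq.
have fiber t : (count (fun p => p.1 == t) s <= if V t then 3 else 1)%N.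
  rewrite -size_filter -(size_map snd); set ys := map _ _.
  have Uys : uniq ys.
    rewrite map_inj_in_uniq ?filter_uniq // => -[t1 y1] [t2 y2].
    by rewrite !mem_filter /= => /andP[/eqP-> _] /andP[/eqP-> _] ->.
  have Nys y : y \in ys -> fiber_node e1 e2 e3 e4 t y.
    by case/mapP => -[t1 y1]; rewrite mem_filter /= => /andP[/eqP-> /N] /= ? ->.
  case: ifP => [vt|/negP nV]; first exact: (vertical_fiber_size fr vt).
  case: ys Uys Nys => [|y [|y' ys]] //= /andP[]; rewrite inE negb_or => /andP[yy' _] _ Nys.
  by case: nV; apply: (fiber_node_vertical yy'); apply: Nys; rewrite !inE eqxx ?orbT.
have order t : t \in ts -> ('X - t%:P) ^+ (if V t then 4 else 2) %| fiber_disc e1 e2 e3 e4.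
  rewrite mem_undup => /mapP[p /N fn ->]; case: ifP => [|_]; first exact: vertical_dvdp.
  exact: fiber_node_dvdp fn.
(* The orders sum to less than 13, so [4 a + 2 b <= 12] for [a] vertical and [b] other fibres; with
   [a <= 3] and at most [3 a + b] points this gives 9. *)
have := leq_trans (sum_root_orders (fiber_disc_neq0 fr) Ut order)
  (size_fiber_disc _ _ _ _).
have sumV a b : (\sum_(t <- ts) (if V t then a else b) =
    a * count V ts + b * count (predC V) ts)%N.
  rewrite (bigID V) /=; congr (_ + _)%N; rewrite -sum1_count big_distrr /=.
    by apply: eq_bigr => t ->; rewrite muln1.
  by apply: eq_bigr => t /negPf->; rewrite muln1.
have : (size s <= 3 * count V ts + 1 * count (predC V) ts)%N.
  by rewrite (size_partition fst) -sumV; apply: leq_sum.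
have : (count V ts <= 3)%N.
  rewrite -size_filter; apply: (size_verticals fr); first exact: filter_uniq.
  exact: filter_all.
rewrite sumV; move: (count V ts) (count _ ts) => a b; lia.
Qed.

(** * Existence of a hyperbolic frame *)

Hypothesis P_neq0 : P != 0.

Lemma polar_radical z : (forall y, T P z y = 0) -> (z <= P)%MS.
Proof. by move=> /(nodal P_neq0 P_sing)/sub_rVP. Qed.

Lemma T_sum2 (I : finType) (c : I -> K) (v : I -> V) x z :
  T x (\sum_i c i *: v i) z = \sum_i c i * T x (v i) z.
Proof.
elim/big_rec2: _ => [|i a b _ <-]; first by rewrite T12 T01.
by rewrite !TE.
Qed.

Lemma T_coord x y z : T x y z = \sum_i y 0 i * T x (delta_mx 0 i) z.
Proof. by rewrite {1}[y]row_sum_delta T_sum2. Qed.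

(** Three linear conditions in dimension 5 leave a kernel of dimension at least 2, which the line of
    [P] cannot contain. *)
Lemma orthogonal_avoiding w1 w2 w3 :
  exists z, [/\ ~~ (z <= P)%MS, T P z w1 = 0, T P z w2 = 0 & T P z w3 = 0].
Proof.
pose w j : V := [:: w1; w2; w3]`_j.
pose M := \matrix_(i < 5, j < 3) T P (delta_mx 0 i) (w j).
have /row_subPn[i zP] : ~~ (kermx M <= P)%MS.
  apply: contraTN (rank_leq_col M) => /mxrankS; rewrite mxrank_ker => le1.
  by have := leq_trans le1 (rank_leq_row P); rewrite -ltnNge leq_subLR addn1.
exists (row i (kermx M)); have E j : (j < 3)%N -> T P (row i (kermx M)) (w j) = 0.
  move=> j3; have /sub_kermxP/rowP/(_ (Ordinal j3)) := row_sub i (kermx M).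
  rewrite [LHS]mxE [RHS]mxE T_coord => E0; rewrite -[RHS]E0.
  by apply: eq_bigr => l _; rewrite [M _ _]mxE.
by split=> //; [exact: (E 0) | exact: (E 1) | exact: (E 2)].
Qed.

(** If [z1] and [z2] are orthogonal and anisotropic, [z1 + c z2] is isotropic for a suitable square
    root [c]. *)
Lemma isotropic_avoiding w1 w2 :
  exists z, [/\ ~~ (z <= P)%MS, T P z w1 = 0, T P z w2 = 0 & T P z z = 0].
Proof.
have [z1 [z1P z11 z12 _]] := orthogonal_avoiding w1 w2 0.
have [q1|q1] := eqVneq (T P z1 z1) 0; first by exists z1.
have [z2 [z2P z21 z22 z2z1]] := orthogonal_avoiding w1 w2 z1.
have [q2|q2] := eqVneq (T P z2 z2) 0; first by exists z2.
pose c := sqrtC (- T P z1 z1 / T P z2 z2).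
have c2 : c ^+ 2 * T P z2 z2 = - T P z1 z1 by rewrite sqrtCK divfK.
exists (z1 + c *: z2); split.
- apply: contra q1 => /sub_rVP[a /(congr1 (fun z => T P z z1))].
  by rewrite !TE z2z1 P_sing !mulr0 addr0 => ->.
- by rewrite !TE z11 z21 mulr0 addr0.
- by rewrite !TE z12 z22 mulr0 addr0.
- by rewrite !TE (T23 P z1 z2) z2z1 mulr0 addr0 add0r mulrA -expr2 c2 subrr.
Qed.

Lemma polar_partner z : ~~ (z <= P)%MS -> exists w, T P z w != 0.
Proof.
move=> zP; have [/existsP[i wi]|] := boolP [exists i, T P z (delta_mx 0 i) != 0].
  by exists (delta_mx 0 i).
rewrite negb_exists => /forallP H; case/negP: zP; apply: polar_radical => y.
rewrite T23 T_coord big1 // => i _.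
by have := H i; rewrite negbK T23 => /eqP->; rewrite mulr0.
Qed.

(** Modulo [P] the form [T P] splits into two hyperbolic planes, spanned by [e1, e4] and by
    [e2, e3]. *)
Lemma frame_exists : exists e1 e2 e3 e4, frame e1 e2 e3 e4 1.
Proof.
have [e1 [e1P _ _ h11]] := isotropic_avoiding 0 0.
have [w c0] := polar_partner e1P; set c := T P e1 w in c0.
have [e4 h14 h44] : exists2 e4, T P e1 e4 = 1 & T P e4 e4 = 0.
  (* [w] is rescaled to pair to 1 with [e1], then corrected by a multiple of [e1] to become
     isotropic. *)
  exists (c^-1 *: w - (T P w w / (2%:R * c ^+ 2)) *: e1).
    by rewrite -scaleNr !TE h11 mulr0 addr0 mulVf.
  rewrite -scaleNr !TE; sortT e1 w; rewrite h11 -/c; by field.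
have [e2 [e2P h21 h24 h22]] := isotropic_avoiding e1 e4.
have [w' d0] := polar_partner e2P; set d := T P e2 w' in d0.
have [w2 [w21 w24 w22]] : exists w2, [/\ T P e1 w2 = 0, T P e4 w2 = 0 & T P e2 w2 = d].
  (* Projection of [w'] to the orthogonal of [e1, e4]; the pairing with [e2] is kept since [e2] is
     orthogonal to both. *)
  exists (w' - T P w' e4 *: e1 - T P w' e1 *: e4).
  rewrite -!scaleNr !TE h11 h14 h21 h24 h44 (T23 P w' e1) (T23 P w' e4) (T23 P e4 e1) h14 -/d.
  by split; ring.
have h12 : T P e1 e2 = 0 by rewrite T23.
have h42 : T P e4 e2 = 0 by rewrite T23.
have [e3 [h13 h23 h34 h33]] : exists e3,
    [/\ T P e1 e3 = 0, T P e2 e3 = - 1, T P e3 e4 = 0 & T P e3 e3 = 0].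
  exists ((- d^-1) *: w2 + (T P w2 w2 / (2%:R * d ^+ 2)) *: e2).
  rewrite !TE w21 w22 h12 h22 (T23 P w2 e4) w24 h24 (T23 P w2 e2) w22.
  by split; [ring | field | ring | field].
exists e1, e2, e3, e4; split=> //; first exact: oner_neq0.
pose M := \matrix_(i < 5) ([:: P; e1; e2; e3; e4]`_i : V).
have ME (u : V) : u *m M = u 0 0 *: P + (u 0 (inord 1) *: e1 + u 0 (inord 2) *: e2
    + (u 0 (inord 3) *: e3 + u 0 (inord 4) *: e4)).
  rewrite mulmx_sum_row !big_ord_recl big_ord0 !rowK /= addr0 -!addrA.
  by congr (u 0 _ *: _ + (u 0 _ *: _ + (u 0 _ *: _ + (u 0 _ *: _ + u 0 _ *: _))));
    apply: val_inj; rewrite /= ?inordK.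
(* Pairing a relation with [e4, e3, e2, e1] under [T P] reads off its last four coefficients up to
   sign. *)
have Mu : M \in unitmx.
  rewrite -row_free_unit -kermx_eq0; apply/rowV0P => u /sub_kermxP; rewrite ME => u0.
  have h := (P_sing, h11, h12, h13, h14, h22, h23, h24, h33, h34, h44).
  have t0 y : T P 0 y = 0 by rewrite T12 T01.
  have u1 := congr1 (fun z => T P z e4) u0; have u2 := congr1 (fun z => T P z e3) u0.
  have u3 := congr1 (fun z => T P z e2) u0; have u4 := congr1 (fun z => T P z e1) u0.
  move: u1 u2 u3 u4; rewrite !TE; sort5 P e1 e2 e3 e4; rewrite !h !t0.
  rewrite !(mulr0, addr0, add0r, mulr1, mulrN, oppr0) => u1 /eqP; rewrite oppr_eq0 => /eqP u2.
  move=> /eqP; rewrite oppr_eq0 => /eqP u3 u4.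
  move: u0; rewrite u1 u2 u3 u4 !scale0r !addr0 => /eqP.
  rewrite scaler_eq0 (negPf P_neq0) orbF => /eqP u0.
  apply/rowP => i; rewrite mxE -(inord_val i).
  by case: i => -[|[|[|[|[|]]]]] //= _; rewrite -?u0; congr (u 0 _);
    apply: val_inj; rewrite /= inordK.
move=> x; rewrite -(mulmxKV Mu x) ME.
by do 5!eexists.
Qed.

(** * Projection from the node onto the Segre quadric *)

Lemma frame_swap_tr e1 e2 e3 e4 k : frame e1 e2 e3 e4 k -> frame e3 e4 e1 e2 (- k).
Proof. by move/frame_transpose/frame_swap/frame_transpose. Qed.

Lemma rank1_factor (c1 c2 c3 c4 : K) : c1 * c4 = c2 * c3 ->
  [|| c1 != 0, c2 != 0, c3 != 0 | c4 != 0] ->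
  exists u v : K * K, [/\ u != (0, 0), v != (0, 0), c1 = u.1 * v.1, c2 = u.1 * v.2 &
    c3 = u.2 * v.1 /\ c4 = u.2 * v.2].
Proof.
move=> E; have [c10 /= nz|c10 _] := eqVneq c1 0; last first.
  exists (1, c3 / c1), (c1, c2); rewrite !xpair_eqE oner_eq0 (negPf c10) /= !mul1r.
  split=> //; split; first by rewrite divfK.
  by apply: (mulfI c10); rewrite E; field.
move: E nz; rewrite c10 mul0r => /esym/eqP; rewrite mulf_eq0.
have [-> /= _ nz|c20 /= /eqP-> _] := eqVneq c2 0.
  exists (0, 1), (c3, c4); rewrite !xpair_eqE oner_eq0 andbF -negb_and in nz *.
  by rewrite nz /= !mul0r !mul1r.
exists (1, c4 / c2), (0, c2); rewrite !xpair_eqE oner_eq0 (negPf c20) andbF /= !mul1r.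
by split=> //; rewrite mulr0 divfK.
Qed.

(** The equation [T x x P = 0] reads [2 k (c1 c4 - c2 c3) = 0], so the coordinate matrix has rank
    one and is a column times a row. *)
Lemma vanishing_segre e1 e2 e3 e4 k x : frame e1 e2 e3 e4 k ->
  vanishing T x -> ~~ (x <= P)%MS ->
  exists (c : K) (u v : K * K), [/\ u != (0, 0), v != (0, 0) &
    x = c *: P + (u.1 *: (v.1 *: e1 + v.2 *: e2) + u.2 *: (v.1 *: e3 + v.2 *: e4))].
Proof.
move=> fr xS xP; have [c0 [c1 [c2 [c3 [c4 Ex]]]]] := fr_span fr x.
case: (fr) => k0 h11 h12 h13 h14 h22 h23 h24 h33 h34 h44 _.
have n2 : 2%:R != 0 :> K by rewrite pnatr_eq0.
have E : c1 * c4 = c2 * c3.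
  have PP y : T P P y = 0 by apply: P_sing.
  have := xS P; rewrite T23 T12 Ex !TE; sort5 P e1 e2 e3 e4.
  rewrite !PP h11 h12 h13 h14 h22 h23 h24 h33 h34 h44 => q0.
  apply/eqP; rewrite -subr_eq0; apply/eqP.
  by apply: (mulfI k0); apply: (mulfI n2); rewrite !mulr0 -[RHS]q0; ring.
have nz : [|| c1 != 0, c2 != 0, c3 != 0 | c4 != 0].
  apply: contraR xP; rewrite !negb_or !negbK => /and4P[/eqP z1 /eqP z2 /eqP z3 /eqP z4].
  by rewrite Ex z1 z2 z3 z4 !scale0r !addr0; apply: scalemx_sub.
have [u [v [u0 v0 E1 E2 [E3 E4]]]] := rank1_factor E nz.
exists c0, u, v; split=> //; rewrite Ex E1 E2 E3 E4.
by rewrite !scalerDr !scalerA.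
Qed.

Lemma generic_frame (I : finType) (x : I -> V) :
  (forall i, vanishing T (x i)) -> (forall i, ~~ (x i <= P)%MS) ->
  exists e1 e2 e3 e4 k, frame e1 e2 e3 e4 k /\
  exists (c l t y : I -> K), forall i, l i != 0 /\
    x i = c i *: P + l i *: (e1 + t i *: e3 + y i *: (e2 + t i *: e4)).
Proof.
move=> xS xP; have [e1 [e2 [e3 [e4 fr]]]] := frame_exists.
have /fin_all_exists[c] := fun i => vanishing_segre fr (xS i) (xP i).
move=> /fin_all_exists[u] /fin_all_exists[v] H.
have [s us] : exists s, forall i, (u i).1 - s * (u i).2 != 0.
  by apply: exists_generic_shear => i; case: (H i).
have [r vr] : exists r, forall i, (v i).1 - r * (v i).2 != 0.
  by apply: exists_generic_shear => i; case: (H i).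
(* Conjugation by the exchange of rows adds [s] times the first row of frame vectors to the second,
   turning [u.1] into [u.1 - s * u.2]; [fr2] does the same with columns. *)
have fr1 := frame_swap_tr (frame_shear s (frame_swap_tr fr)).
have fr2 := frame_swap (frame_shear_tr r (frame_swap fr1)).
do 5!eexists; split; first exact: fr2.
exists c, (fun i => ((u i).1 - s * (u i).2) * ((v i).1 - r * (v i).2)),
  (fun i => (u i).2 / ((u i).1 - s * (u i).2)), (fun i => (v i).2 / ((v i).1 - r * (v i).2)).
move=> i; split; first by rewrite mulf_neq0.
have [_ _ {1}->] := H i; congr (_ + _).
have := us i; have := vr i; move: (u i) (v i) => [u1 u2] [v1 v2] /= nv nu.
by apply/rowP => j; rewrite !mxE; field; rewrite nu nv.
Qed.

(** If [T P a z = 0], then [T x x z] for [x = c P + l a] reduces to [l^2 T a a z]. In the frame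
    moved to [(t, y)], this applies to [a] and its two tangent directions. *)
Lemma vanishing_fiber_node e1 e2 e3 e4 k c l t y : frame e1 e2 e3 e4 k -> l != 0 ->
  vanishing T (c *: P + l *: (e1 + t *: e3 + y *: (e2 + t *: e4))) ->
  fiber_node e1 e2 e3 e4 t y.
Proof.
move=> fr l0 xS.
have fr1 := frame_shear_tr y (frame_shear t fr).
rewrite /fiber_node /=; move: xS fr1.
move: (e3 + y *: e4) (e1 + t *: e3 + y *: (e2 + t *: e4)) => f3 f1.
move: (e2 + t *: e4) => f2 xS fr1.
suff key z : T P f1 z = 0 -> T f1 f1 z = 0.
  by split; apply: key; [exact: fr11 fr1 | exact: fr12 fr1 | exact: fr13 fr1].
move=> h; have := xS z; have PP y' : T P P y' = 0 by apply: P_sing.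
rewrite !TE (T12 f1 P) PP h !(mulr0, add0r) => /eqP.
by rewrite !mulf_eq0 (negPf l0) => /eqP.
Qed.

(** At [x = c P + l a] the equation [T x x e4 = 0] becomes [2 k c = - l T a a e4], so [a] fixes the
    ratio of [c] to [l]. *)
Lemma fiber_node_inj e1 e2 e3 e4 k c l c' l' t y : frame e1 e2 e3 e4 k ->
  l != 0 -> l' != 0 ->
  let a := e1 + t *: e3 + y *: (e2 + t *: e4) in
  vanishing T (c *: P + l *: a) -> vanishing T (c' *: P + l' *: a) ->
  ((c' *: P + l' *: a)%R <= (c *: P + l *: a)%R)%MS.
Proof.
move=> fr l0 l'0 a /(_ e4) xS /(_ e4) xS'.
have fr1 := frame_shear_tr y (frame_shear t fr).
have k0 := fr_k fr; have := fr14 fr1; rewrite -/a => h.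
move: a h xS xS' => a h xS xS'; have PP z : T P P z = 0 by apply: P_sing.
have n2 : 2%:R != 0 :> K by rewrite pnatr_eq0.
suff E : c' = l' / l * c.
  by apply/sub_rVP; exists (l' / l); rewrite scalerDr !scalerA E divfK.
move: xS xS'; rewrite !TE (T12 a P) !PP h => E E'.
have F d m : m != 0 -> d * (d * 0) + d * (m * k) + (m * (d * k) + m * (m * T a a e4)) = 0 ->
    2%:R * k * d = - m * T a a e4.
  move=> m0 H; apply: (mulfI m0); apply/eqP; rewrite -subr_eq0.
    by rewrite -[X in _ == X]H; apply/eqP; ring.
apply: (mulfI (mulf_neq0 n2 k0)).
rewrite (F c' l' l'0 E') mulrCA (F c l l0 E); by field.
Qed.

Lemma vanishing_card (I : finType) (x : I -> V) :
  (forall i, vanishing T (x i)) -> (forall i, ~~ (x i <= P)%MS) ->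
  (forall i j, i != j -> ~~ (x j <= x i)%MS) -> (#|I| <= 9)%N.
Proof.
move=> xS xP xx; have [e1 [e2 [e3 [e4 [k [fr]]]]]] := generic_frame xS xP.
case=> c [l [t [y H]]].
rewrite cardE -(size_map (fun i => (t i, y i))).
apply: (fiber_nodes_size fr).
  rewrite map_inj_uniq ?enum_uniq // => i j [tij yij]; apply/eqP.
  apply: contraT => /xx /negP; case.
  have [[li xi] [lj xj]] := (H i, H j); have := xS i; have := xS j.
  by rewrite xi xj tij yij => xjS xiS; apply: (fiber_node_inj fr).
move=> p /mapP[i _ ->]; have [li xi] := H i.
by apply: (vanishing_fiber_node fr li (c := c i)); rewrite -xi.
Qed.

End NodalForm.

(** * Homogeneous polynomials and Euler's identity *)

Section Homogeneous.
Variables (n : nat) (K : comNzRingType).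
Implicit Types p : {mpoly K[n]}.

Lemma mderiv_homog d i p : p \is d.+1.-homog -> p^`M(i) \is d.-homog.
Proof.
move=> /dhomogP hp; apply/dhomogP => m; rewrite mcoeff_msupp mcoeff_mderiv => nz.
have : (m + U_(i))%MM \in msupp p.
  by rewrite mcoeff_msupp; apply: contraNneq nz => ->; rewrite mul0rn.
by move/hp => /=; rewrite mdegD mdeg1 addn1 => -[].
Qed.

Lemma euler_homog d p : p \is d.-homog -> \sum_i 'X_i * p^`M(i) = d%:R *: p.
Proof.
move=> /dhomogP hp; rewrite {2}[p]mpolyE scaler_sumr.
transitivity (\sum_i \sum_(m <- msupp p) 'X_i * (p@_m *: 'X_[m])^`M(i)).
  by apply: eq_bigr => i _; rewrite -mulr_sumr {1}[p]mpolyE linear_sum.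
rewrite exchange_big; apply: eq_big_seq => m /hp /= <-.
rewrite mdegE natr_sum scaler_suml; apply: eq_bigr => i _.
rewrite mderivZ mderivX -!scalerAr [RHS]scalerA [_%:R * _]mulrC -scalerA; congr (_ *: _).
have [->|mi] := eqVneq (m i) 0%N; first by rewrite !scale0r.
by rewrite -mpolyXD addmC submK // lep1mP.
Qed.

Lemma euler_meval d p (v : 'I_n -> K) : p \is d.-homog ->
  d%:R * p.@[v] = \sum_i v i * p^`M(i).@[v].
Proof.
move=> hp; rewrite -mevalZ -(euler_homog hp) raddf_sum.
by apply: eq_bigr => i _ /=; rewrite mevalM mevalXU.
Qed.

Lemma meval_homogZ d p (t : K) (v : 'I_n -> K) : p \is d.-homog ->
  p.@[fun i => t * v i] = t ^+ d * p.@[v].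
Proof.
move=> /dhomogP hp; rewrite !mevalE mulr_sumr; apply: eq_big_seq => m /hp /= <-.
rewrite mulrCA; congr (_ * _); rewrite mdegE -prodrXr -big_split /=.
by apply: eq_bigr => i _; rewrite exprMn.
Qed.
End Homogeneous.

(** * The polar form of a cubic polynomial *)

Section CubicForm.
Variables (n : nat) (K : numClosedFieldType) (F : {mpoly K[n]}).
Hypothesis F_cubic : F \is 3.-homog.
Implicit Types x y z : 'rV[K]_n.

(* The third derivatives of a cubic form are constants. *)
Definition cubic_form x y z : K :=
  \sum_i \sum_j \sum_k x 0 i * y 0 j * z 0 k * F^`M(i)^`M(j)^`M(k)@_0.

Lemma cubic_form_lin a x x' y z :
  cubic_form (a *: x + x') y z = a * cubic_form x y z + cubic_form x' y z.
Proof.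
rewrite /cubic_form mulr_sumr -big_split; apply: eq_bigr => i _ /=.
rewrite mulr_sumr -big_split; apply: eq_bigr => j _ /=.
rewrite mulr_sumr -big_split; apply: eq_bigr => k _ /=.
by rewrite !mxE; ring.
Qed.

Lemma cubic_form12 x y z : cubic_form x y z = cubic_form y x z.
Proof.
rewrite /cubic_form exchange_big; apply: eq_bigr => i _; apply: eq_bigr => j _.
by apply: eq_bigr => k _; rewrite (mderiv_comm j i) [y 0 _ * _]mulrC.
Qed.

Lemma cubic_form23 x y z : cubic_form x y z = cubic_form x z y.
Proof.
rewrite /cubic_form; apply: eq_bigr => i _; rewrite exchange_big.
apply: eq_bigr => j _; apply: eq_bigr => k _.
by rewrite (mderiv_comm k j); congr (_ * _); ring.
Qed.

(** Euler's identity for the first and second derivatives contributes the factors 2 and 1. *)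
Lemma cubic_form_mderiv x y :
  cubic_form x x y = 2%:R * \sum_i y 0 i * F^`M(i).@[x 0].
Proof.
rewrite cubic_form23 cubic_form12 /cubic_form mulr_sumr; apply: eq_bigr => i _.
have Fi : F^`M(i) \is 2.-homog by apply: mderiv_homog.
rewrite mulrCA (euler_meval _ Fi) mulr_sumr; apply: eq_bigr => j _ /=.
have Fij : F^`M(i)^`M(j) \is 1.-homog by apply: mderiv_homog.
rewrite -[_.@[_]]mul1r (euler_meval _ Fij) !mulr_sumr; apply: eq_bigr => k _ /=.
have /dhomogP Fijk : F^`M(i)^`M(j)^`M(k) \is 0.-homog by apply: mderiv_homog.
suff -> : F^`M(i)^`M(j)^`M(k) = (F^`M(i)^`M(j)^`M(k)@_0)%:MP.
  by rewrite mevalC mcoeffC eqxx mulr1; ring.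
apply/mpolyP => m; rewrite mcoeffC.
have [->|m0] := eqVneq m 0%MM; first by rewrite mulr1.
rewrite mulr0; apply: memN_msupp_eq0; apply: contra m0 => /Fijk /= /eqP.
by rewrite mdeg_eq0.
Qed.

Lemma cubic_form_diag x : cubic_form x x x = 6%:R * F.@[x 0].
Proof.
rewrite cubic_form_mderiv (_ : 6%:R = 2%:R * 3%:R); last by rewrite -natrM.
by rewrite -mulrA (euler_meval _ F_cubic).
Qed.

Lemma cubic_form_vanishing x :
  (forall i, F^`M(i).@[x 0] = 0) <-> vanishing cubic_form x.
Proof.
split=> [h y|h i].
  by rewrite cubic_form_mderiv big1 ?mulr0 // => i _; rewrite h mulr0.
have := h (delta_mx 0 i); rewrite cubic_form_mderiv => /eqP.
rewrite mulf_eq0 pnatr_eq0 /= (bigD1 i) //= !mxE !eqxx mul1r big1 ?addr0 => [/eqP //|j ji].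
by rewrite mxE (negPf ji) andbF mul0r.
Qed.

End CubicForm.

(** * From singular points and nodes to the polar form *)

Section Bridge.
Variables (n : nat) (K : numClosedFieldType) (F : {mpoly K[n.+1]}).
Hypothesis F_cubic : F \is 3.-homog.
Notation T := (cubic_form F).
Implicit Types P Q : projspace K n.

Definition homogeneous_vector P : 'rV[K]_n.+1 := vpick (val P).

Lemma homogeneous_vector_neq0 P : homogeneous_vector P != 0.
Proof. by rewrite vpick0 -dimv_eq0 (eqP (valP P)). Qed.

Lemma homogeneous_vector_line P : val P = <[homogeneous_vector P]>%VS.
Proof.
apply/esym/eqP; rewrite eqEdim -memvE memv_pick dim_vline.
by rewrite homogeneous_vector_neq0 (eqP (valP P)).
Qed.

Lemma homogeneous_vector_inj P Q :
  (homogeneous_vector Q <= homogeneous_vector P)%MS -> P = Q.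
Proof.
case/sub_rVP => c E; apply/val_inj/esym/eqP.
rewrite eqEdim (eqP (valP P)) (eqP (valP Q)) andbT homogeneous_vector_line.
by rewrite -memvE E memvZ // memv_pick.
Qed.

Lemma singular_pointE P : singular_point F P <-> vanishing T (homogeneous_vector P).
Proof.
split=> [[_ h]|h]; first exact/(cubic_form_vanishing F_cubic).
split; last exact/(cubic_form_vanishing F_cubic).
have /eqP := h (homogeneous_vector P); rewrite (cubic_form_diag F_cubic).
by rewrite mulf_eq0 pnatr_eq0 => /eqP.
Qed.

(** Along the line [t v] the value of [f] is a polynomial in [t] whose coefficients are the
    homogeneous components at [v]. *)
Lemma meval_pihomog (f : {mpoly K[n]}) (v : 'I_n -> K) (a : K) (p : {poly K}) (d : nat) :
  (forall t, a * f.@[fun i => t * v i] = p.[t]) ->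
  a * (pihomog mdeg d f).@[v] = p`_d.
Proof.
move=> fp; pose k := maxn (msize f) d.+1.
have -> : p = \poly_(e < k) (a * (pihomog mdeg e f).@[v]).
  apply: horner_inj => t; rewrite -fp horner_poly.
  rewrite {1}(@pihomog_partitionE _ _ mdeg k f) ?leq_maxl // raddf_sum mulr_sumr.
  apply: eq_bigr => e _ /=; rewrite (meval_homogZ _ _ (pihomogP _ _ _)).
  by rewrite -mulrA; congr (_ * _); rewrite mulrC.
by rewrite coef_poly leq_maxr.
Qed.

Definition chart_vector (i : 'I_n.+1) (v : 'I_n -> K) : 'rV[K]_n.+1 :=
  \row_j (if unlift i j is Some k then v k else 0).

Lemma meval_local_equation P i (v : 'I_n -> K) :
  (local_equation F P i).@[v] =
  F.@[((homogeneous_vector P 0 i)^-1 *: homogeneous_vector P + chart_vector i v) 0].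
Proof.
rewrite /local_equation comp_mpoly_meval; apply: meval_eq => j.
rewrite tnth_mktuple mevalD mevalC !mxE; congr (_ + _); first by rewrite mulrC.
by case: unlift => [k|]; rewrite ?mevalXU ?meval0.
Qed.

(** The coefficient of [t^2] in [6 F(x + t w)], the polar form on the diagonal, is [3 T x w w]. *)
Lemma meval_local_quadratic P i (v : 'I_n -> K) :
  2%:R * (pihomog mdeg 2 (local_equation F P i)).@[v] =
  T ((homogeneous_vector P 0 i)^-1 *: homogeneous_vector P)
    (chart_vector i v) (chart_vector i v).
Proof.
have T_lin := cubic_form_lin F; have T12 := cubic_form12 F; have T23 := cubic_form23 F.
have wE t : chart_vector i (fun k => t * v k) = t *: chart_vector i v.
  by apply/rowP => j; rewrite !mxE; case: unlift => [k|] //; rewrite mulr0.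
have fE t := meval_local_equation P i (fun k => t * v k).
move: (_^-1 *: _) (chart_vector i v) wE fE => x w wE fE.
have n3 : 3%:R != 0 :> K by rewrite pnatr_eq0.
apply: (mulfI n3); rewrite mulrA -natrM.
rewrite (@meval_pihomog _ _ _ (\poly_(d < 4)
  [:: T x x x; 3%:R * T x x w; 3%:R * T x w w; T w w w]`_d)); first by rewrite coef_poly.
move=> t; rewrite fE wE -(cubic_form_diag F_cubic).
rewrite horner_poly !big_ord_recr big_ord0 /= !(trilinE T_lin T12 T23).
by rewrite !(T12 w x) !(T23 _ w x) !(T12 w x); ring.
Qed.

(** Subtracting a multiple of [x] from [z] makes its [i]-th coordinate 0; the resulting chart vector
    lies in the radical of the local quadratic part, which is trivial. *)
Lemma ordinary_double_point_nondegenerate P z :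
  ordinary_double_point F P -> (forall y, T (homogeneous_vector P) z y = 0) ->
  exists c, z = c *: homogeneous_vector P.
Proof.
move=> [[/singular_pointE xS _] [i [xi _ [_ nd]]]] xz.
have T_lin := cubic_form_lin F; have T12 := cubic_form12 F; have T23 := cubic_form23 F.
have n2 : 2%:R != 0 :> K by rewrite pnatr_eq0.
move: xi; rewrite /hcoord -/(homogeneous_vector P) => xi.
have qE := meval_local_quadratic P i.
move: (homogeneous_vector P) xS xz xi qE => x xS xz xi qE.
pose c := z 0 i / x 0 i; pose z' := z - c *: x.
pose u : 'rV[K]_n := \row_k z' 0 (lift i k).
have zE : chart_vector i (u 0) = z'.
  apply/rowP => j; rewrite !mxE; case: unliftP => [k|] ->; first by rewrite !mxE.
  by rewrite divfK // subrr.
suff u0 : u = 0.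
  exists c; apply/eqP; rewrite -subr_eq0 -/z' -zE u0; apply/eqP/rowP => j.
  by rewrite !mxE; case: unlift => [k|] //; rewrite mxE.
apply: nd => v; apply: (mulfI n2); rewrite mulr0 !mulrBr !qE.
have -> : chart_vector i ((u + v) 0) = chart_vector i (u 0) + chart_vector i (v 0).
  by apply/rowP => j; rewrite !mxE; case: unlift => [k|]; rewrite ?mxE ?addr0.
have z'0 y : T x z' y = 0.
  by rewrite /z' -scaleNr (trilinD2 T_lin T12) (trilinZ2 T_lin T12) xz xS mulr0 addr0.
rewrite zE; move: {u zE} z' z'0 (chart_vector i (v 0)) => u u0 w.
by rewrite !(trilinE T_lin T12 T23) (T23 x w) !u0; ring.
Qed.

End Bridge.

(** * The bound for nodal cubics *)

Section NodeBound.
Variables (K : numClosedFieldType) (F : {mpoly K[5]}).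
Hypothesis F_cubic : F \is 3.-homog.
Hypothesis F_nodal : forall P : projspace K 4,
  singular_point F P -> ordinary_double_point F P.
Notation T := (cubic_form F).

Lemma cubic_form_nodal (x : 'rV[K]_5) : x != 0 -> vanishing T x ->
  forall z, (forall y, T x z y = 0) -> exists c, z = c *: x.
Proof.
have T_lin := cubic_form_lin F; have T12 := cubic_form12 F; have T23 := cubic_form23 F.
move=> x0 xS z xz; have dimx : \dim <[x]>%VS == 1%N by rewrite dim_vline x0.
pose P : projspace K 4 := exist _ <[x]>%VS dimx.
have [a xE] : exists a, homogeneous_vector P = a *: x by apply/vlineP/memv_pick.
have PS : singular_point F P.
  by apply/(singular_pointE F_cubic) => y; rewrite xE
    (trilinZ1 T_lin) (trilinZ2 T_lin T12) xS !mulr0.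
have [|c ->] := ordinary_double_point_nondegenerate F_cubic (F_nodal PS) (z := z).
  by move=> y; rewrite xE (trilinZ1 T_lin) xz mulr0.
by exists (c * a); rewrite xE scalerA.
Qed.

(** One node serves as the centre [P]; the others give at most 9 pairwise independent vectors off
    its line. *)
Lemma nodes_card (I : finType) (p : I -> projspace K 4) : injective p ->
  (forall i, ordinary_double_point F (p i)) -> (#|I| <= 10)%N.
Proof.
move=> p_inj p_odp; case: (pickP I) => [i0 _|/eq_card0->] //.
have p_sing i : vanishing T (homogeneous_vector (p i)).
  by apply/(singular_pointE F_cubic); case: (p_odp i) => -[].
have p_indep i j : i != j -> ~~ (homogeneous_vector (p j) <= homogeneous_vector (p i))%MS.
  by apply: contraNN => /homogeneous_vector_inj/p_inj->.
rewrite (cardD1 i0) /= add1n ltnS -[#|_|]card_sig.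
by apply: (vanishing_card (cubic_form_lin F) (cubic_form12 F) (cubic_form23 F)
  (p_sing i0) cubic_form_nodal (homogeneous_vector_neq0 (p i0))
  (x := fun i => homogeneous_vector (p (val i)))) => [i|i|i j ij];
  [exact: p_sing | apply: p_indep; rewrite eq_sym; case/andP: (valP i)
  | exact: p_indep].
Qed.

End NodeBound.

Local Open Scope classical_set_scope.

Theorem proposition1p1 (R : realType) (F : {mpoly (complex R)[5]})
    (F_cubic : F \is 3.-homog)
    (F_irreducible : irreducible_elt F)
    (F_nodal : forall P : projspace (complex R) 4,
       singular_point F P -> ordinary_double_point F P) :
  ([set P : projspace (complex R) 4 | ordinary_double_point F P]
     #<= `I_10)%card.
Proof.
set A := [set P | _].
have [//|A_gt10] := boolP (A #<= `I_10)%card.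
(* If the bound fails, 11 distinct nodes can be chosen, whether the set of nodes is finite or
   infinite. *)
have : ([set: 'I_11] #<= A)%card.
  rewrite -(card_le_eql card_II).
  have [/finite_setP[m mA]|/infiniteP] := pselect (finite_set A); last first.
    by apply: card_le_trans; apply: subset_card_le.
  move: A_gt10; rewrite (card_le_eql mA) (card_le_eqr mA) !card_le_II.
  by rewrite -ltnNge.
case/card_leP => f; pose p i := set_val (f (to_setT i)).
have p_inj : injective p.
  move=> i j /val_inj fij.
  have /(congr1 val) := inj (mem_setT (to_setT i)) (mem_setT (to_setT j)) fij.
  by [].
have p_odp i : ordinary_double_point F (p i) by exact: set_valP (f (to_setT i)).
by have := nodes_card F_cubic F_nodal p_inj p_odp; rewrite card_ord.
Qed.
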